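(* Let $G$ be a finite group. Suppose that every non-subnormal primary subgroup of $G$ satisfies the Frobenius normalizer condition in $G$. Then $G$ is of one of the following types: (a) $G$ is nilpotent. (b) $G$ is soluble and $G$ has a Sylow basis $P_{1},\ldots,P_{t}$ such that: (i) for some $1\leq r<t$ the subgroups $P_{1},\ldots,P_{r}$ are normal in $G$, $P_{i}$ is not normal in $G$ for all $i>r$, and $E=P_{r+1}\cdots P_{t}$ is nilpotent; (ii) $F(G)$ is a maximal nilpotent subgroup of $G$ and $F(G)=F_{0}(G)Z_{\infty}(G)$, where $F_{0}(G)=P_{1}\cdots P_{r}$; (iii) $N_{G}(E)$ is a Carter subgroup of $G$; (iv) $V_{G}=Z_{\infty}(G)$ for every maximal nilpotent subgroup $V$ of $G$ such that $G=F(G)V$. Conversely, if $G$ is a finite group of type (a) or (b), then every non-subnormal primary subgroup of $G$ satisfies the Frobenius normalizer condition in $G$.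
   Context: All groups are finite. A finite group $P$ is primary if $|P|=p^{a}$ for some prime $p$. A primary subgroup $P$ of $G$ that is a $p$-group satisfies the Frobenius normalizer condition in $G$ if $N_G(P)/C_G(P)$ is a $p$-group. $F(G)$ is the Fitting subgroup of $G$. $Z_{\infty}(G)$ is the hypercentre of $G$: the product of all hypercentral normal subgroups of $G$, where a normal subgroup $N$ is hypercentral in $G$ if $N=1$ or every chief factor $H/K$ of $G$ below $N$ satisfies $C_G(H/K)=G$. $V_G$ denotes the core of $V$ in $G$, i.e. the largest normal subgroup of $G$ contained in $V$. A Sylow basis of $G$ is a set of Sylow subgroups of $G$, exactly one for each prime dividing $|G|$, that are pairwise permutable ($P_iP_j=P_jP_i$). A maximal nilpotent subgroup of $G$ is a subgroup maximal (under inclusion) among the nilpotent subgroups of $G$. A Carter subgroup of $G$ is a nilpotent subgroup $U$ of $G$ with $N_G(U)=U$. *)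

(* Defs.v *)
From mathcomp Require Import all_boot all_fingroup all_solvable.

Set Implicit Arguments.
Unset Strict Implicit.
Unset Printing Implicit Defensive.

Local Open Scope group_scope.

Section Defs.

Variable gT : finGroupType.
Implicit Types G H K N P U V : {group gT}.

Definition primary P : Prop := exists p a : nat, prime p /\ #|P| = (p ^ a)%N.

(* The prime p is determined by P unless P is trivial, in which case P is a
   p-group for every p and the quotient is trivial. *)
Definition frobenius_normalizer_condition G P : Prop :=
  forall p : nat, prime p -> p.-group P -> p.-group ('N_G(P) / 'C_G(P)).

(* [chief_factor G K H] says that H / K is a chief factor of G. *)
Definition hypercentral G N : bool :=
  (N <| G) &&
  ((N :==: 1) ||
   [forall H : {group gT}, forall K : {group gT},
      chief_factor G K H && (H \subset N) ==> ('C_G(H / K | 'Q) == G)]).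

(* A product of subsets; it is a subgroup because the factors are normal. *)
Definition hypercentre G : {set gT} :=
  \prod_(N : {group gT} | hypercentral G N) (N : {set gT}).

Definition maximal_nilpotent G V : bool :=
  [max V of W | (W \subset G) && nilpotent W].

(* The argument is a set so that it can be applied to 'N_G(E) with E given as
   a product of subgroups. *)
Definition carter_subgroup G (U : {set gT}) : Prop :=
  [/\ group_set U, U \subset G, nilpotent U & 'N_G(U) = U].

(* An enumeration P_0, ..., P_(t-1) of a Sylow basis; it has no repetitions
   because of the uniqueness of i in the second clause. *)
Definition sylow_basis G (t : nat) (P : 'I_t -> {group gT}) : Prop :=
  [/\ forall i, exists2 p : nat, p \in \pi(G) & p.-Sylow(G) (P i),
      forall p : nat, p \in \pi(G) -> exists! i, p.-Sylow(G) (P i)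
    & forall i j, P i * P j = P j * P i].

(* Indices start at 0: the normal members of the basis are the P i with i < r,
   and F0 and E are products of subsets, E being a subgroup by permutability. *)
Definition type_b G : Prop :=
  solvable G /\
  exists (t : nat) (P : 'I_t -> {group gT}), sylow_basis G P /\
  exists r : nat,
    let F0 := \prod_(i < t | (i < r)%N) (P i : {set gT}) in
    let E := \prod_(i < t | (r <= i)%N) (P i : {set gT}) in
    [/\ [/\ (0 < r < t)%N,
            forall i : 'I_t, (i < r)%N -> P i <| G,
            forall i : 'I_t, (r <= i)%N -> ~~ (P i <| G)
          & nilpotent E],
        maximal_nilpotent G 'F(G)%G /\ 'F(G) = F0 * hypercentre G,
        carter_subgroup G 'N_G(E)
      & forall V : {group gT}, maximal_nilpotent G V ->
          G = 'F(G) * V :> {set gT} -> gcore V G = hypercentre G].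

End Defs.

(* Main.v *)
(* If a Sylow p-subgroup of G is not normal, then G is p-nilpotent. Indeed every
   p-subgroup not contained in O_p(G) is non-subnormal, so Frobenius' theorem
   makes G / O_p(G) p-nilpotent. Let Q be a Sylow q-subgroup with q != p. If Q is
   normal it centralizes O_p(G), as they meet trivially; otherwise a Frattini
   argument yields a Sylow p-subgroup of G of the form O_p(G) P1 with P1
   normalizing Q, and the hypotheses on Q and on O_p(G) P1 force Q to
   centralize O_p(G). Hence G / C_G(O_p(G)) is a p-group, all p-subgroups
   satisfy the Frobenius condition and Frobenius' theorem applies to G itself.
   So the normal Sylow subgroups generate a normal nilpotent Hall subgroup D with
   nilpotent complements E, from which all of (b) is read off. Conversely, clause
   (i) alone makes G p-nilpotent for each p whose Sylow subgroups are not normal.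

   Frobenius' theorem is obtained by transfer: an induction on Sylow intersections
   shows that a Sylow subgroup controls fusion of its own elements. *)
Require Import Defs.
From mathcomp Require Import all_boot all_fingroup all_solvable.
From mathcomp Require Import ssralg.

Set Implicit Arguments.
Unset Strict Implicit.
Unset Printing Implicit Defensive.

Local Open Scope group_scope.

(** * Frobenius' normal p-complement theorem *)

Definition frobenius_at (gT : finGroupType) (p : nat) (G : {group gT}) :=
  forall Q : {group gT}, Q \subset G -> p.-group Q -> p.-group ('N_G(Q) / 'C_G(Q)).

(** [R] maps onto a Sylow subgroup of the p-group [N / C], hence onto all of it. *)
Lemma mul_normal_Sylow (gT : finGroupType) (p : nat) (C N R : {group gT}) :
  C <| N -> p.-group (N / C) -> p.-Sylow(N) R -> C * R = N.
Proof.
move=> nsCN pNC sylR; have [sCN nCN] := andP nsCN; have sRN := pHall_sub sylR.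
have sylRC: p.-Sylow(N / C) (R / C).
  by apply: quotient_pHall (subset_trans sRN nCN) sylR.
apply/eqP; rewrite eqEsubset mul_subG //=.
by rewrite -quotientSK // (pHall_id sylRC pNC).
Qed.

(** Let [D = S :&: T] be proper in [S]. The normalizers of [D] in [S] and [T] exceed [D] and lie in
    Sylow subgroups [R] and [R2] of ['N_G(D)], which is the product of [R] and ['C_G(D)]; so some
    [z] in ['C_G(D)] conjugates [R] to [R2]. A Sylow subgroup [S1] of [G] over [R] meets [S], and
    [S1 :^ z] meets [T], in more than [D], and induction applies to both pairs. *)
Lemma Sylow_conj_cent_inter (gT : finGroupType) (G : {group gT}) (p : nat) :
  frobenius_at p G ->
  forall S T : {group gT}, p.-Sylow(G) S -> p.-Sylow(G) T ->
  exists2 c, c \in 'C_G(S :&: T) & T :=: S :^ c.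
Proof.
move=> frobG S T; have [n] := ubnP (#|S| - #|S :&: T|).
elim: n S T => // n IHn S T ltn sylS sylT; set D := (S :&: T)%G.
have [sSG pS _] := and3P sylS; have [sTG pT _] := and3P sylT.
have cardST: #|T| = #|S| by rewrite (card_Hall sylS) (card_Hall sylT).
have [eqDS | neqDS] := eqVneq (D : {set gT}) S.
  exists 1; rewrite ?group1 // conjsg1; apply/esym/eqP.
  by rewrite eqEcard cardST leqnn andbT -eqDS subsetIr.
have prDS: D \proper S by rewrite properEneq neqDS subsetIl.
have prDT: D \proper T.
  rewrite properEcard subsetIr cardST; exact: proper_card prDS.
have sDG : D \subset G by rewrite (subset_trans (subsetIl _ _)).
have pD : p.-group D by apply: pgroupS pS; apply: subsetIl.
(* A larger intersection has a smaller centralizer, so the element given by induction still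
   centralizes [D]. *)
have IH (S1 T1 : {group gT}) :
    p.-Sylow(G) S1 -> p.-Sylow(G) T1 -> D \proper S1 :&: T1 ->
    exists2 c, c \in 'C_G(D) & T1 :=: S1 :^ c.
  move=> sylS1 sylT1 prD1; case: (IHn S1 T1) => //.
    rewrite (card_Hall sylS1) -(card_Hall sylS).
    by rewrite (leq_trans _ (ltnSE ltn)) // ltn_sub2l // proper_card.
  move=> c cDc defT1; exists c => //; apply: subsetP cDc.
  by rewrite setIS // centS // proper_sub.
have pNC := frobG D sDG pD.
have sSN : 'N_S(D) \subset 'N_G(D) by rewrite setSI.
have sTN : 'N_T(D) \subset 'N_G(D) by rewrite setSI.
have [R sylR sSR] := Sylow_superset sSN (pgroupS (subsetIl _ _) pS).
have [R2 sylR2 sTR2] := Sylow_superset sTN (pgroupS (subsetIl _ _) pT).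
have nsCN: 'C_G(D) <| 'N_G(D) by exact: subcent_normal.
have [x Nx defR2] := Sylow_trans sylR sylR2.
have /mulsgP[y z Ry Cz defx] : x \in R * 'C_G(D).
  rewrite (normC (subset_trans (pHall_sub sylR) (normal_norm nsCN))).
  by rewrite (mul_normal_Sylow nsCN pNC sylR).
rewrite {x Nx}defx conjsgM (conjGid Ry) in defR2.
have sRG : R \subset G by rewrite (subset_trans (pHall_sub sylR)) ?subsetIl.
have [S1 sylS1 sRS1] := Sylow_superset sRG (pHall_pgroup sylR).
have [Gz _] := setIP Cz.
have sylT1: p.-Sylow(G) (S1 :^ z)%G by rewrite pHallJ.
have nilS := pgroup_nil pS; have nilT := pgroup_nil pT.
have [|c1 Cc1 defS1] := IH S S1 sylS sylS1.
  apply: proper_sub_trans (nilpotent_proper_norm nilS prDS) _.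
  by rewrite subsetI subsetIl (subset_trans sSR).
have [|c2 Cc2 defT] := IH (S1 :^ z)%G T sylT1 sylT.
  apply: proper_sub_trans (nilpotent_proper_norm nilT prDT) _.
  rewrite subsetI subsetIl andbT (subset_trans sTR2) //= defR2 conjSg //.
exists (c1 * z * c2); first by rewrite !groupM.
by rewrite !conjsgM -defS1.
Qed.

Lemma Sylow_controls_fusion (gT : finGroupType) (G P : {group gT}) (p : nat) :
  frobenius_at p G ->
  p.-Sylow(G) P ->
  forall x g, x \in P -> g \in G -> x ^ g \in P ->
  exists2 y, y \in P & x ^ g = x ^ y.
Proof.
move=> frobG sylP x g Px Gg Pxg; have [sPG pP _] := and3P sylP.
have sylPg : p.-Sylow(G) (P :^ g)%G by rewrite pHallJ.
have [c Cc defP] := Sylow_conj_cent_inter frobG sylPg sylP.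
have [Gc /centP cc] := setIP Cc.
have Ngc: g * c \in 'N_G(P).
  rewrite inE groupM //=; apply/normP; rewrite conjsgM; exact/esym.
have sylPN : p.-Sylow('N_G(P)) P.
  by apply: pHall_subl sylP; rewrite ?subsetIl // subsetI sPG normG.
have := mul_normal_Sylow (subcent_normal _ _) (frobG P sPG pP) sylPN.
move/setP/(_ (g * c)); rewrite Ngc => /mulsgP[d y Cd Py defgc].
have [_ /centP cd] := setIP Cd.
exists y => //; have -> : x ^ g = x ^ (g * c).
  rewrite conjgM /conjg -(cc (x ^ g)) ?mulKg //.
  by rewrite inE memJ_conjg Px.
by rewrite defgc conjgM; congr (_ ^ _); apply/conjg_fixP/commgP/esym/cd.
Qed.

Lemma p_elt_expg_p'_eq1 (gT : finGroupType) (p : nat) (x : gT) (n : nat) :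
  p.-elt x -> p^'.-nat n -> x ^+ n = 1 -> x = 1.
Proof.
move=> px p'n /eqP; rewrite -order_dvdn => dvx; apply/eqP.
by rewrite -order_eq1 (pnat_1 px) // (pnat_dvd dvx).
Qed.

Lemma fusion_control_p_quotient (gT : finGroupType) (G P : {group gT}) (p : nat) :
    p.-Sylow(G) P -> P :!=: 1 ->
    (forall x g, x \in P -> g \in G -> x ^ g \in P ->
       exists2 y, y \in P & x ^ g = x ^ y) ->
  exists K : {group gT}, [/\ K <| G, K \proper G & p.-group (G / K)].
Proof.
move=> sylP ntP fusP; have [sPG pP _] := and3P sylP.
have nP'P : P \subset 'N(P^`(1)) := der_norm 1 P.
pose alpha := restrm_morphism nP'P (coset_morphism P^`(1)).
have defA : alpha @* P = P / P^`(1) by rewrite morphim_restrm setIid.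
have abelA : abelian (alpha @* P) by rewrite defA der_abelian.
have pA : p.-group (alpha @* P) by rewrite morphim_pgroup.
pose tau := transfer_morphism G abelA.
have valA (z : FiniteModule.fmod_of abelA) : p.-elt (\val z).
  by apply: mem_p_elt pA _; apply: FiniteModule.fmodP.
have tau0 (x : gT) : x \in G -> p^'.-elt x -> x \in 'ker tau.
  move=> Gx p'x; apply/kerP=> //; apply: val_inj.
  apply: (p_elt_expg_p'_eq1 (valA (tau x)) p'x).
  rewrite -FiniteModule.fmvalZ.
  have -> : (tau x *+ #[x])%R = tau (x ^+ #[x])%g by rewrite morphX.
  by rewrite expg_order morph1.
have alphaJ z y : z \in P -> y \in P -> alpha (z ^ y) = alpha z.
  move=> Pz Py; rewrite morphJ //; apply/conjg_fixP/commgP.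
  by apply: (centsP abelA); apply: mem_morphim.
exists ('ker tau)%G; split; first exact: ker_normal.
- rewrite properEneq normal_sub ?ker_normal // andbT.
  apply: contraNneq ntP => defG; apply/eqP.
  suffices sPP' : P \subset P^`(1).
    apply: contraTeq sPP' => ntP; rewrite proper_subn //.
    exact: (sol_der1_proper (pgroup_sol pP) (subxx P) ntP).
  apply/subsetP=> g Pg; have Gg := subsetP sPG g Pg.
  have: g \in 'ker tau by rewrite defG.
  move/mker; have trX := transversalP (rcosets_cycle_partition sPG Gg).
  rewrite /= (transfer_cycle_expansion sPG abelA Gg trX).
  set X := transversal _ _ in trX *.
  (* Each term comes from a conjugate in [P] of a power of [g]; by fusion control they are conjugate
     in [P], hence have the same image under [alpha]. The cycle lengths add up to [#|G : P|]. *)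
  rewrite (eq_bigr (fun x => FiniteModule.fmod abelA (alpha g)
                             *+ #|<[g]> : P :* x|)%R) => [|x Xx]; last first.
    set n := #|_ : _|; have Gx : x \in G.
      by apply: subsetP Xx; apply: transversal_sub trX.
    have [||| y Py eq_y] := fusP (g ^+ n) x^-1; rewrite ?groupX ?groupV //.
      by rewrite conjgE invgK mulgA -mem_rcoset mulg_exp_card_rcosets.
    rewrite -FiniteModule.fmodX ?mem_morphim // -morphX // -(alphaJ _ y) ?groupX //.
    by rewrite -eq_y.
  rewrite GRing.sumrMnr (sum_index_rcosets_cycle sPG Gg trX).
  move/(congr1 val); rewrite FiniteModule.fmvalZ /= => /p_elt_expg_p'_eq1 alpha1.
  have: alpha g = 1.
    rewrite -(FiniteModule.fmodK abelA (mem_morphim _ Pg Pg)).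
    apply: alpha1; first exact: valA.
    by have [] := and3P sylP.
  exact: coset_idr (subsetP nP'P g Pg).
- apply/pgroupP=> q q_pr /(Cauchy q_pr)[_ /morphimP[x Nx Gx ->] oq].
  suffices: p.-elt (coset ('ker tau) x) by rewrite /p_elt oq pnatE.
  rewrite -[x](consttC p) morphM ?groupX //=.
  rewrite (coset_id (tau0 x.`_p^' _ _)) ?mulg1 ?p_elt_constt ?groupX //.
  by rewrite morph_p_elt ?groupX ?p_elt_constt.
Qed.

Lemma quotient_pgroup_mem (gT : finGroupType) (pi : nat_pred) (C N : {group gT}) x :
  C <| N -> pi.-group (N / C) -> x \in N -> pi^'.-elt x -> x \in C.
Proof.
move=> nsCN piNC Nx pi'x; have Ncx := subsetP (normal_norm nsCN) x Nx.
apply: (coset_idr Ncx); apply/eqP; rewrite -order_eq1.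
have pix : pi.-elt (coset C x) by apply: mem_p_elt piNC _; apply: mem_quotient.
by apply/eqP; apply: pnat_1 pix (morph_p_elt (coset_morphism C) Ncx pi'x).
Qed.

Lemma quotient_pgroup_prime (gT : finGroupType) (pi : nat_pred) (C N : {group gT}) :
    C <| N ->
    (forall q, prime q -> q \notin pi -> forall x, x \in N -> q.-elt x -> x \in C) ->
  pi.-group (N / C).
Proof.
move=> nsCN memC; apply/pgroupP=> q q_pr /(Cauchy q_pr)[_ /morphimP[x Nx Gx ->] oq].
apply: contraT => pi'q; have qx : q.-elt (coset C x) by rewrite /p_elt oq pnat_id.
have: #[coset C x] != 1%N by rewrite oq neq_ltn prime_gt1 ?orbT.
rewrite order_eq1 -(constt_p_elt qx) -morph_constt //= coset_id ?eqxx //.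
by apply: memC q_pr pi'q _ _ (p_elt_constt _ _); rewrite groupX.
Qed.

(** A normal p-complement, if there is one, is ['O_p^'(G)]. *)
Definition p_nilpotent (gT : finGroupType) (p : nat) (G : {set gT}) :=
  p^'.-Hall(G) 'O_p^'(G).

Lemma p_nilpotentE (gT : finGroupType) (p : nat) (G : {group gT}) :
  p_nilpotent p G = p.-group (G / 'O_p^'(G)).
Proof.
rewrite /p_nilpotent /pHall pcore_sub pcore_pgroup /= /pgroup.
by rewrite card_quotient ?gFnorm // (eq_pnat _ (negnK _)).
Qed.

(** The p'-elements of [G] lie in [K], hence in ['O_p^'(K)], which is characteristic in [K] and so
    normal in [G]. *)
Lemma p_nilpotent_normal (gT : finGroupType) (p : nat) (K G : {group gT}) :
  K <| G -> p.-group (G / K) -> p_nilpotent p K -> p_nilpotent p G.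
Proof.
move=> nsKG pGK pnK; rewrite p_nilpotentE.
apply: quotient_pgroup_prime (pcore_normal _ _) _ => q q_pr p'q x Gx qx.
have p'x : p^'.-elt x by apply: pi_pnat qx _.
have Kx := quotient_pgroup_mem nsKG pGK Gx p'x.
have: x \in 'O_p^'(K) by rewrite (mem_Hall_pcore pnK).
apply/subsetP; rewrite pcore_max ?pcore_pgroup //.
exact: gFnormal_trans.
Qed.

Lemma frobenius_atP (gT : finGroupType) (p : nat) (G : {group gT}) :
  frobenius_at p G <->
  forall Q : {group gT}, Q \subset G -> p.-group Q ->
  forall x, x \in 'N_G(Q) -> p^'.-elt x -> x \in 'C(Q).
Proof.
split=> frobG Q sQG pQ.
  move=> x Nx p'x.
  have := quotient_pgroup_mem (subcent_normal _ _) (frobG Q sQG pQ) Nx p'x.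
  by case/setIP.
apply: quotient_pgroup_prime (subcent_normal _ _) _ => q q_pr p'q x Nx qx.
apply/setIP; split; first by case/setIP: Nx.
by apply: frobG => //; apply: (pi_pnat qx).
Qed.

Lemma frobenius_atS (gT : finGroupType) (p : nat) (H G : {group gT}) :
  H \subset G -> frobenius_at p G -> frobenius_at p H.
Proof.
move=> sHG /frobenius_atP frobG; apply/frobenius_atP=> Q sQH pQ x /setIP[Hx Nx].
by apply: frobG; rewrite ?(subset_trans sQH) // inE Nx (subsetP sHG).
Qed.

Theorem frobenius_p_nilpotent (gT : finGroupType) (p : nat) (G : {group gT}) :
  frobenius_at p G -> p_nilpotent p G.
Proof.
have [n] := ubnP #|G|; elim: n G => // n IHn G /ltnSE leGn frobG.
have [P sylP] := Sylow_exists p G.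
have [P1 | ntP] := eqVneq (P : {set gT}) 1.
  have p'G : p^'.-group G.
    by rewrite /pgroup -partn_eq1 // -(card_Hall sylP) P1 cards1.
  by rewrite p_nilpotentE pcore_pgroup_id // trivg_quotient pgroup1.
have fusP := Sylow_controls_fusion frobG sylP.
have [K [nsKG prK pGK]] := fusion_control_p_quotient sylP ntP fusP.
apply: (p_nilpotent_normal nsKG pGK); apply: IHn.
  exact: leq_trans (proper_card prK) leGn.
exact: frobenius_atS (normal_sub nsKG) frobG.
Qed.

(** The commutator of [Q] with a p'-element normalizing it lies both in [Q] and in ['O_p^'(G)]. *)
Lemma p_nilpotent_frobenius (gT : finGroupType) (p : nat) (G : {group gT}) :
  p_nilpotent p G -> frobenius_at p G.
Proof.
move=> pnG; apply/frobenius_atP=> Q sQG pQ x /setIP[Gx Nx] p'x.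
have Ox : x \in 'O_p^'(G) by rewrite (mem_Hall_pcore pnG).
have tiOQ : 'O_p^'(G) :&: Q = 1.
  by rewrite setIC coprime_TIg // (pnat_coprime pQ (pcore_pgroup _ _)).
rewrite -sub1set; apply/commG1P/trivgP; rewrite -tiOQ.
apply: commg_subI; rewrite ?subsetI ?sub1set ?Ox //= subxx.
by rewrite (subset_trans sQG) // gFnorm.
Qed.

(** * Groups whose non-subnormal primary subgroups satisfy the Frobenius condition *)

(** Induction along a subnormal chain: if [K] is normal in [G], so is its characteristic subgroup
    ['O_pi(K)]. *)
Lemma subnormal_pgroup_pcore (gT : finGroupType) (pi : nat_pred) (Q G : {group gT}) :
  Q <|<| G -> pi.-group Q -> Q \subset 'O_pi(G).
Proof.
have [n] := ubnP #|G|; elim: n G => // n IHn G /ltnSE leGn snQ piQ.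
have [defQ | [K [snQK nsKG prKG]]] := subnormalEr snQ.
  by rewrite pcore_max // defQ normal_refl.
have sQK := IHn K (leq_trans (proper_card prKG) leGn) snQK piQ.
apply: subset_trans sQK _; apply: pcore_max (pcore_pgroup _ _) _.
exact: gFnormal_trans.
Qed.

Section NonSubnormalPrimary.

Variables (gT : finGroupType) (G : {group gT}).
Hypothesis frobG : forall P : {group gT}, P \subset G -> primary P ->
  ~~ (P <|<| G) -> frobenius_normalizer_condition G P.

Lemma p'_norm_cent (p : nat) (Q : {group gT}) (x : gT) :
    prime p -> Q \subset G -> p.-group Q -> ~~ (Q \subset 'O_p(G)) ->
    x \in 'N_G(Q) -> p^'.-elt x -> x \in 'C(Q).
Proof.
move=> p_pr sQG pQ notQO Nx p'x.
have primQ : primary Q by have [k] := p_natP pQ; exists p, k.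
have nsnQ : ~~ (Q <|<| G).
  by apply: contra notQO => snQ; apply: subnormal_pgroup_pcore.
have := quotient_pgroup_mem (subcent_normal _ _) (frobG sQG primQ nsnQ p_pr pQ) Nx p'x.
by case/setIP.
Qed.

(** A nontrivial p-subgroup of the quotient lifts to a p-group not contained in ['O_p(G)], to which
    the hypothesis applies. *)
Lemma frobenius_at_quotient_pcore (p : nat) :
  prime p -> frobenius_at p (G / 'O_p(G)).
Proof.
move=> p_pr; apply/frobenius_atP => Qb sQb pQb xb.
case/setIP=> [/morphimP[x0 nOx0 Gx0 ->] Nxb] p'xb.
set R := 'O_p(G) in Qb sQb pQb x0 nOx0 Gx0 Nxb p'xb *.
have nRG : G \subset 'N(R) by apply: gFnorm.
(* Passing to the p'-part gives a p'-element in the same coset. *)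
pose x := x0.`_p^'; have Gx : x \in G by rewrite groupX.
have nRx := subsetP nRG x Gx.
have defx : coset R x0 = coset R x.
  by rewrite /x morph_constt //= constt_p_elt.
have [Q defQ sRQ sQG] := inv_quotientS (pcore_normal _ _) sQb.
have pQ : p.-group Q.
  by rewrite -(pquotient_pgroup (pcore_pgroup p G)) ?(subset_trans sQG) // -defQ.
rewrite /= defx in Nxb *.
have [sQR | nsQR] := boolP (Q \subset R).
  have Qb1 : Qb :=: 1.
    by rewrite defQ; apply/trivgP; rewrite quotient_sub1 // (subset_trans sQG).
  by rewrite Qb1 cent1T inE.
have nsRQ : R <| Q by rewrite /normal sRQ (subset_trans sQG).
have NQx : x \in 'N(Q).
  rewrite -sub1set -(quotientSGK _ (subset_trans sRQ (normG Q))) ?sub1set //=.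
  by rewrite quotient_normG // -defQ quotient_set1 // sub1set.
have Cx : x \in 'C(Q).
  by apply: (p'_norm_cent p_pr) => //; [apply/setIP | apply: p_elt_constt].
by rewrite defQ (subsetP (quotient_cent _ _)) // mem_quotient.
Qed.

Lemma nonnormal_Sylow_p_nilpotent (p : nat) (P : {group gT}) :
  prime p -> p.-Sylow(G) P -> ~~ (P <| G) -> p_nilpotent p G.
Proof.
move=> p_pr sylP nnP; set R := 'O_p(G).
have nRG : G \subset 'N(R) := gFnorm _ _.
have nsRG : R <| G := pcore_normal _ _.
have pR : p.-group R := pcore_pgroup _ _.
have pnGR := frobenius_p_nilpotent (frobenius_at_quotient_pcore p_pr).
(* [K / R] is the normal p-complement of [G / R]: thus [K] contains all p'-elements of [G], and its
   p-elements lie in [R]. *)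
have [K defK sRK nsKG] := inv_quotientN nsRG (pcore_normal p^' (G / R)).
have p'K x : x \in G -> p^'.-elt x -> x \in K.
  move=> Gx p'x; have nRx := subsetP nRG x Gx.
  have : [set x] / R \subset K / R.
    rewrite quotient_set1 // sub1set -defK (mem_Hall_pcore pnGR) ?mem_quotient //.
    exact: (morph_p_elt (coset_morphism R)).
  by rewrite quotientSGK ?sub1set.
have pK x : x \in K -> p.-elt x -> x \in R.
  move=> Kx px; have nRx := subsetP nRG x (subsetP (normal_sub nsKG) x Kx).
  apply: (coset_idr nRx); apply/eqP; rewrite -order_eq1.
  apply/eqP; apply: (pnat_1 (morph_p_elt (coset_morphism R) nRx px)).
  by apply: mem_p_elt (pcore_pgroup p^' (G / R)) _; rewrite /= defK mem_quotient.
have nnSyl (S : {group gT}) : p.-Sylow(G) S -> ~~ (S \subset R).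
  move=> sylS; apply: contra nnP => sSR.
  have defS : S :=: R.
    apply/eqP; rewrite eqEsubset sSR; exact: pcore_sub_Hall.
  have [x Gx ->] := Sylow_trans sylS sylP.
  by rewrite defS (normsP nRG) // nsRG.
have cRQ (q : nat) (Q : {group gT}) :
  q != p -> prime q -> q.-Sylow(G) Q -> Q \subset 'C(R).
  move=> neqp q_pr sylQ; have [sQG qQ _] := and3P sylQ.
  have p'Q : p^'.-group Q by apply: pi_pnat qQ _; rewrite inE /= inE.
  have sQK : Q \subset K.
    by apply/subsetP=> x Qx; rewrite p'K ?(subsetP sQG) // (mem_p_elt p'Q).
  have [nsQG | nnQ] := boolP (Q <| G).
    have tiQR : Q :&: R = 1 by rewrite setIC coprime_TIg // (pnat_coprime pR).
    apply/commG1P/trivgP; rewrite -tiQR commg_subI // subsetI subxx //=.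
      by rewrite (subset_trans sQG).
    by rewrite (subset_trans (pcore_sub _ _)) // normal_norm.
  have [P1 sylP1] := Sylow_exists p 'N_G(Q).
  have [sP1N pP1 _] := and3P sylP1.
  have [sP1G nQP1] := subsetIP sP1N.
  have nsKN : 'N_K(Q) <| 'N_G(Q).
    have := normalGI (subsetIl G 'N(Q)) nsKG.
    by rewrite setIAC (setIidPr (normal_sub nsKG)).
  have pNK : p.-group ('N_G(Q) / 'N_K(Q)).
    apply: quotient_pgroup_prime nsKN _ => r r_pr p'r x /setIP[Gx Nx] rx.
    by rewrite inE Nx p'K //; apply: pi_pnat rx _.
  (* By Frattini, [G] is the product of [K] and ['N_G(Q)]; the latter is the product of ['N_K(Q)]
     and [P1], since its p'-elements lie in [K]. *)
  have defG : K * P1 = G.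
    have sylQK : q.-Sylow(K) Q by apply: pHall_subl sylQ => //; apply: normal_sub.
    rewrite -(Frattini_arg nsKG sylQK) -(mul_normal_Sylow nsKN pNK sylP1) mulgA.
    by rewrite (mulGSid (subsetIl _ _)).
  have nRP1 : P1 \subset 'N(R) := subset_trans sP1G nRG.
  have pRP1 : p.-group (R <*> P1) by rewrite norm_joinEr // pgroupM pR.
  have sRP1G : R <*> P1 \subset G by rewrite join_subG pcore_sub.
  have [S sylS sRS] := Sylow_superset sRP1G pRP1.
  have [sSG pS _] := and3P sylS.
  (* By Dedekind's law [S] is the product of [S :&: K] and [P1], and [S :&: K] consists of
     p-elements of [K]. *)
  have defS : S :=: R <*> P1.
    apply/eqP; rewrite eqEsubset sRS andbT -(setIidPl sSG) -defG.
    rewrite -group_modr ?(subset_trans (joing_subr _ _) sRS) //.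
    rewrite norm_joinEr // mulSg //; apply/subsetP=> x /setIP[Sx Kx].
    by rewrite pK // (mem_p_elt pS).
  have sQO : ~~ (Q \subset 'O_q(G)).
    apply: contra nnQ => sQO; suffices -> : Q :=: 'O_q(G) by apply: pcore_normal.
    by apply/eqP; rewrite eqEsubset sQO pcore_sub_Hall.
  (* The hypothesis at q makes [P1] centralize [Q]. Hence [Q] normalizes [S], and the hypothesis at
     p makes it centralize [S], which contains [R]. *)
  have cP1Q : P1 \subset 'C(Q).
    apply/subsetP=> x P1x; apply: (p'_norm_cent q_pr sQG qQ sQO).
      exact: subsetP sP1N x P1x.
    by apply: pi_pnat (mem_p_elt pP1 P1x) _; rewrite inE /= inE eq_sym.
  have sRS' : R \subset S := subset_trans (joing_subl _ _) sRS.
  apply/subsetP=> x Qx; apply: (subsetP (centS sRS')).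
  apply: (p'_norm_cent p_pr sSG pS (nnSyl S sylS)).
    rewrite inE (subsetP sQG) //=; apply: (subsetP _ x Qx).
    rewrite defS; apply: normsY; first exact: subset_trans sQG nRG.
    by rewrite cents_norm // centsC.
  exact: mem_p_elt p'Q Qx.
(* The hypothesis covers [Q] outside [R]; inside [R], [Q] is centralized by all p'-elements because
   [G / 'C_G(R)] is a p-group. *)
apply: frobenius_p_nilpotent; apply/frobenius_atP=> Q sQG pQ x Nx p'x.
have [sQR | ] := boolP (Q \subset R); last by move/(p'_norm_cent p_pr sQG pQ)->.
apply: (subsetP (centS sQR)).
have pGC : p.-group (G / 'C_G(R)).
  apply: quotient_pgroup_prime => [|q q_pr p'q y Gy qy].
    by rewrite -{1}(setIidPl nRG) subcent_normal.
  have syQ : <[y]> \subset G by rewrite cycle_subG.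
  have [S sylS] := Sylow_superset syQ qy.
  rewrite cycle_subG => Sy; rewrite inE Gy.
  apply: (subsetP (cRQ _ _ _ q_pr sylS) y Sy); by move: p'q; rewrite inE.
have Gx : x \in G by case/setIP: Nx.
have nsC : 'C_G(R) <| G by rewrite -{2}(setIidPl nRG) subcent_normal.
by have /setIP[] := quotient_pgroup_mem nsC pGC Gx p'x.
Qed.

End NonSubnormalPrimary.

(** * The hypercentre *)

Lemma group1_prodg (gT : finGroupType) (I : Type) (r : seq I) (P : pred I)
    (F : I -> {group gT}) :
  1 \in \prod_(i <- r | P i) (F i : {set gT}).
Proof.
elim/big_rec: _ => [|i A _ A1]; first exact: group1.
by rewrite -[1]mulg1 mem_mulg.
Qed.

Lemma sub_prodg (gT : finGroupType) (I : eqType) (r : seq I) (P : pred I)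
    (F : I -> {group gT}) i :
  i \in r -> P i -> F i \subset \prod_(j <- r | P j) (F j : {set gT}).
Proof.
move=> r_i Pi; elim: r r_i => //= j r IHr; rewrite inE big_cons.
case/predU1P => [<- | /IHr sFi]; first by rewrite Pi mulg_subl ?group1_prodg.
by case: ifP => // _; apply: subset_trans sFi _; apply: mulg_subr.
Qed.

Lemma prodg_sub (gT : finGroupType) (I : Type) (r : seq I) (P : pred I)
    (F : I -> {group gT}) (H : {group gT}) :
  (forall i, P i -> F i \subset H) -> \prod_(i <- r | P i) (F i : {set gT}) \subset H.
Proof.
by move=> sFH; elim/big_ind: _ => [|A B sAH sBH|//]; rewrite ?sub1G ?mul_subG.
Qed.

Lemma chief_factor_central (gT : finGroupType) (G K H : {group gT}) :
  chief_factor G K H -> ('C_G(H / K | 'Q) == G) = ([~: H, G] \subset K).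
Proof.
case/andP=> /maxgroupp/andP[prKH nKG] /andP[sHG _].
rewrite astabQ (sameP eqP setIidPl) -sub_quotient_pre // centsC.
by rewrite quotient_cents2 // (subset_trans sHG).
Qed.

(** For a chief factor [N / K], centrality puts [[~: N, G]] in [K], so [N] lies one stage above [K]
    in the upper central series, and [#|K| < #|N|]. *)
Lemma hypercentral_sub_ucn (gT : finGroupType) (G N : {group gT}) :
  hypercentral G N -> N \subset 'Z_(#|N|)(G).
Proof.
have [n] := ubnP #|N|; elim: n N => // n IHn N /ltnSE leNn /andP[nsNG].
case/predU1P => [-> | hypN]; first exact: sub1G.
have [-> | ntN] := eqVneq (N : {set gT}) 1; first exact: sub1G.
have [K maxK _] : {K : {group gT} | maxnormal K N G & 1%G \subset K}.
  by apply: maxgroup_exists; rewrite proper1G ntN norms1.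
have chiefK : chief_factor G K N by apply/andP.
have /andP[prKN nKG] := maxgroupp maxK; have sKN := proper_sub prKN.
have hypK : hypercentral G K.
  rewrite /hypercentral /normal (subset_trans sKN (normal_sub nsNG)) nKG /=.
  apply/orP; right; apply/forallP=> H1; apply/forallP=> K1.
  apply/implyP=> /andP[ch sHK].
  have /forallP/(_ H1)/forallP/(_ K1) := hypN.
  by rewrite ch (subset_trans sHK sKN).
have /forallP/(_ N)/forallP/(_ K) := hypN.
rewrite chiefK subxx /= chief_factor_central // => cNG.
have sKZ := IHn K (leq_trans (proper_card prKN) leNn) hypK.
apply: subset_trans (ucn_sub_geq G (proper_card prKN)).
apply/subsetP=> x Nx; rewrite ucnSnR inE (subsetP (normal_sub nsNG)) //=.
by rewrite (subset_trans _ sKZ) // (subset_trans _ cNG) // commSg ?sub1set.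
Qed.

(** If a chief factor [H / K] below ['Z_n(G)] were not central, every [H :&: 'Z_i(G)] would lie in
    [K]: the first that does not generates [H] together with [K], while its commutators with [G]
    fall into the previous one. The case [i = n] is absurd. *)
Lemma ucn_hypercentral (gT : finGroupType) (G : {group gT}) n :
  hypercentral G 'Z_n(G)%G.
Proof.
rewrite /hypercentral ucn_normal; apply/orP; right.
apply/forallP=> H; apply/forallP=> K; apply/implyP=> /andP[chiefHK sHZ].
rewrite chief_factor_central //; case/andP: chiefHK => maxK nsHG.
have /andP[prKH nKG] := maxgroupp maxK; have sKH := proper_sub prKH.
have sHG := normal_sub nsHG.
apply: contraTT (sHZ) => ncHG; rewrite -(setIidPl sHZ).
suffices sHZK i : H :&: 'Z_i(G) \subset K.
  apply/negP=> _; move: (sHZK n); rewrite (setIidPl sHZ).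
  by apply/negP/proper_subn.
elim: i => [|i IHi]; first by rewrite ucn0 setIg1 sub1G.
set M := H :&: _; have nMG : G \subset 'N(M).
  by rewrite normsI ?ucn_norm // normal_norm.
have sMG : M \subset G by rewrite subIset ?sHG.
apply: contraR ncHG => nsMK.
have defH : K * M = H.
  rewrite -norm_joinEr ?(subset_trans sMG) //.
  apply/eqP; rewrite eqEsubset join_subG sKH subsetIl /=.
  apply: contraR nsMK => nsHKM.
  have [_ /(_ (K <*> M)%G)] := maxgroupP maxK.
  rewrite joing_subl /proper join_subG sKH subsetIl nsHKM normsY // => /(_ isT isT) <-.
  exact: joing_subr.
rewrite -quotient_cents2 ?(subset_trans sHG) // -defH quotientMidl.
rewrite quotient_cents2 ?(subset_trans sMG) //; apply: subset_trans IHi.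
rewrite subsetI (subset_trans _ (ucn_comm i G)) ?commSg ?subsetIr // andbT.
by rewrite (subset_trans (commSg _ (subsetIl _ _))) // commg_subl normal_norm.
Qed.

Lemma hypercentreE (gT : finGroupType) (G : {group gT}) :
  hypercentre G = 'Z_(#|G|)(G).
Proof.
apply/eqP; rewrite eqEsubset prodg_sub => [|N hypN].
  apply: (@sub_prodg _ _ _ (hypercentral G) id 'Z_(#|G|)(G)%G).
    exact: mem_index_enum.
  exact: ucn_hypercentral.
apply: subset_trans (hypercentral_sub_ucn hypN) _.
by apply: ucn_sub_geq; apply: subset_leq_card; case/andP: hypN => /andP[].
Qed.

Lemma sub_hypercentre (gT : finGroupType) (G : {group gT}) n :
  'Z_n(G) \subset hypercentre G.
Proof.
apply: (@sub_prodg _ _ _ (hypercentral G) id 'Z_n(G)%G).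
  exact: mem_index_enum.
exact: ucn_hypercentral.
Qed.

(** [G] is the product of ['C_G(N)] and a Sylow p-subgroup [P] containing [N], so [G] acts on [N] as
    the nilpotent group [P] does, and the upper central series of [P] cuts [N] in G-central
    steps. *)
Lemma pgroup_sub_hypercentre (gT : finGroupType) (p : nat) (N G : {group gT}) :
    N <| G -> p.-group N -> p.-group (G / 'C_G(N)) -> N \subset hypercentre G.
Proof.
move=> nsNG pN pGC; have [P sylP] := Sylow_exists p G.
have nsCG : 'C_G(N) <| G.
  by rewrite -{2}(setIidPl (normal_norm nsNG)) subcent_normal.
have defG := mul_normal_Sylow nsCG pGC sylP.
have sNP : N \subset P.
  by apply: subset_trans (pcore_sub_Hall sylP); apply: pcore_max.
have [n defP] := ucnP _ (pgroup_nil (pHall_pgroup sylP)).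
suffices sNZ i : N :&: 'Z_i(P) \subset 'Z_i(G).
  apply: subset_trans (sub_hypercentre G n).
  by rewrite -(setIidPl sNP) -defP.
elim: i => [|i IHi]; first by rewrite !ucn0 subsetIr.
apply/subsetP=> x /setIP[Nx]; rewrite !ucnSnR !inE => /andP[Px sxZ].
rewrite (subsetP (normal_sub nsNG)) //= gen_subG.
apply/subsetP=> _ /imset2P[_ g /set1P-> Gg ->].
move: Gg; rewrite -defG => /mulsgP[c y /setIP[Gc /centP Cc] Py ->].
have -> : [~ x, c * y] = [~ x, y].
  by rewrite !commgEl conjgM (_ : x ^ c = x) // /conjg -Cc ?mulKg.
apply: (subsetP IHi); rewrite inE; apply/andP; split.
  rewrite commgEl groupM ?groupV // memJ_norm //.
  exact: subsetP (subset_trans (pHall_sub sylP) (normal_norm nsNG)) y Py.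
by apply: (subsetP sxZ); rewrite mem_commg ?set11.
Qed.

(** * Groups of type (b) satisfy the condition *)

Lemma prodg_permutable_group (gT : finGroupType) (I : Type) (r : seq I) (P : pred I)
    (F : I -> {group gT}) :
  (forall i j, F i * F j = F j * F i) ->
  exists2 H : {group gT}, H = \prod_(i <- r | P i) (F i : {set gT}) :> {set gT}
    & forall pi : nat_pred, (forall i, P i -> pi.-group (F i)) -> pi.-group H.
Proof.
move=> cFF; elim: r => [|i r [H defH piH]].
  by exists 1%G; rewrite ?big_nil // => pi _; apply: pgroup1.
rewrite big_cons; case: ifP => [Pi | _]; last by exists H.
have cFH : commute (F i : {set gT}) H.
  rewrite defH; elim/big_ind: _ => [|A B cA cB|j _]; first exact: commute1.
    exact: commuteM.
  exact: cFF.
have gFH := introT comm_group_setP cFH.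
exists (Group gFH); rewrite /= ?defH // => pi piF.
by rewrite /= -defH pgroupM piF //= piH.
Qed.

Lemma sylow_basis_p_nilpotent (gT : finGroupType) (G : {group gT}) t
    (P : 'I_t -> {group gT}) r (i0 : 'I_t) p :
    sylow_basis G P -> (forall i : 'I_t, i < r -> P i <| G) ->
    nilpotent (\prod_(i < t | r <= i) (P i : {set gT})) ->
    r <= i0 -> p \in \pi(G) -> p.-Sylow(G) (P i0) ->
  p_nilpotent p G.
Proof.
case=> sylP uniqP cPP nsP nilE le_r_i0 piGp sylPp.
have [E defE _] :=
  prodg_permutable_group (index_enum 'I_t) (fun i : 'I_t => r <= i) cPP.
have [F defF pF] :=
  prodg_permutable_group (index_enum 'I_t) (fun i : 'I_t => i < r) cPP.
rewrite -defE in nilE.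
have sPG i : P i \subset G by have [q _ /pHall_sub] := sylP i.
have sEG : E \subset G by rewrite defE prodg_sub.
have sFG : F \subset G by rewrite defF prodg_sub.
have nFG : G \subset 'N(F).
  rewrite defF; elim/big_ind: _ => [|A B|i lt_i_r]; [exact: norms1 | exact: normsM |].
  exact: normal_norm (nsP i lt_i_r).
(* [i0] is the only index of a Sylow p-subgroup in the basis and [r <= i0], so the factors of [F]
   belong to other primes. *)
have p'F : p^'.-group F.
  apply: pF => i lt_i_r; have [q piGq sylPq] := sylP i.
  apply: pi_pnat (pHall_pgroup sylPq) _; rewrite inE /= inE.
  apply: contraTneq lt_i_r => eqqp; rewrite eqqp in sylPq.
  by have [j [_ uj]] := uniqP p piGp; rewrite -(uj i sylPq) (uj i0 sylPp) -leqNgt.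
have defG : F * E = G.
  rewrite -norm_joinEr ?(subset_trans sEG) //; apply/eqP.
  have sFEG : F <*> E \subset G by rewrite join_subG sFG.
  (* A prime dividing the index of [F <*> E] would divide that of the basis member for this prime,
     which [F <*> E] contains. *)
  rewrite eqEsubset sFEG -indexg_eq1; apply: contraT => neq1.
  have /pdivP[q q_pr q_dv] : 1 < #|G : F <*> E|.
    by rewrite ltn_neqAle eq_sym neq1 indexg_gt0.
  have piGq : q \in \pi(G).
    by rewrite mem_primes q_pr cardG_gt0 (dvdn_trans q_dv) ?dvdn_indexg.
  have [i [sylPi _]] := uniqP q piGq; have /and3P[_ _ q'GP] := sylPi.
  have sPFE : P i \subset F <*> E.
    case: (ltnP i r) => [lt_i_r | le_r_i].
      apply: subset_trans (joing_subl _ _); rewrite defF.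
      by apply: (@sub_prodg _ _ _ (fun i : 'I_t => i < r)); rewrite ?mem_index_enum.
    apply: subset_trans (joing_subr _ _); rewrite defE.
    by apply: (@sub_prodg _ _ _ (fun i : 'I_t => r <= i)); rewrite ?mem_index_enum.
  by rewrite p'natE // -(Lagrange_index sFEG sPFE) dvdn_mulr in q'GP.
have dxE := nilpotent_pcoreC p nilE.
(* This is the normal p-complement of [G]. *)
pose K := (F <*> 'O_p^'(E))%G.
have nFO pi : 'O_pi(E) \subset 'N(F).
  by rewrite (subset_trans (pcore_sub _ _)) ?(subset_trans sEG).
have defK : K :=: F * 'O_p^'(E) by apply: norm_joinEr (nFO _).
have defGK : K * 'O_p(E) = G.
  by rewrite defK -mulgA (dprodWC dxE) defG.
have nsKG : K <| G.
  rewrite /normal join_subG sFG (subset_trans (pcore_sub _ _) sEG) /=.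
  rewrite -{1}defG mul_subG //; first exact: subset_trans (joing_subl _ _) (normG _).
  by apply: normsY; [apply: subset_trans nFG | apply: gFnorm].
have pGK : p.-group (G / K).
  by rewrite -{1}defGK quotientMidl quotient_pgroup ?pcore_pgroup.
apply: (p_nilpotent_normal nsKG pGK).
have p'K : p^'.-group K by rewrite defK pgroupM p'F pcore_pgroup.
by rewrite p_nilpotentE pcore_pgroup_id // trivg_quotient pgroup1.
Qed.

Lemma type_b_frobenius (gT : finGroupType) (G P : {group gT}) :
  type_b G -> P \subset G -> primary P -> ~~ (P <|<| G) ->
  frobenius_normalizer_condition G P.
Proof.
case=> _ [t [B [sylB [r [[_ nsB _ nilE] _ _ _]]]]] sPG _ nsnP p p_pr pP.
have [_ uniqB _] := sylB.
have piGp : p \in \pi(G).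
  rewrite mem_primes p_pr cardG_gt0 /=; apply: dvdn_trans (cardSg sPG).
  have [P1 | ntP] := eqVneq (P : {set gT}) 1.
    by case/negP: nsnP; rewrite P1 normal_subnormal ?normal1.
  by have [] := pgroup_pdiv pP ntP.
have [i [sylBi _]] := uniqB p piGp.
have pnG : p_nilpotent p G.
  case: (ltnP i r) => [lt_i_r | le_r_i].
    (* Inside a normal Sylow subgroup [P] would be subnormal. *)
    case/negP: nsnP; apply: subnormal_trans (normal_subnormal (nsB i lt_i_r)).
    apply: nilpotent_subnormal (pgroup_nil (pHall_pgroup sylBi)) _.
    have := normal_Hall_pcore sylBi (nsB i lt_i_r) => <-.
    rewrite (sub_Hall_pcore _ sPG) //.
    by rewrite (normal_Hall_pcore sylBi (nsB i lt_i_r)).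
  exact: sylow_basis_p_nilpotent sylB nsB nilE le_r_i piGp sylBi.
exact: p_nilpotent_frobenius.
Qed.

(** * Nilpotent extensions of nilpotent Hall subgroups *)

Lemma p_nilpotentS (gT : finGroupType) (p : nat) (H G : {group gT}) :
  H \subset G -> p_nilpotent p G -> p_nilpotent p H.
Proof.
move=> sHG pnG; apply: frobenius_p_nilpotent.
exact: frobenius_atS sHG (p_nilpotent_frobenius pnG).
Qed.

(** A subgroup [H] contained in [[~: H, G]] has trivial image in the p-group [G / 'O_p^'(G)], so it
    is a p'-group for every p. *)
Lemma nilpotent_p_nilpotent (gT : finGroupType) (G : {group gT}) :
  (forall p, prime p -> p_nilpotent p G) -> nilpotent G.
Proof.
move=> pnG; apply/forall_inP=> H; rewrite subsetI => /andP[sHG sHR].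
have p'H p : prime p -> p^'.-group H.
  move=> p_pr; have := pnG p p_pr; rewrite p_nilpotentE => /pgroup_nil.
  set O := 'O_p^'(G); have nOG : G \subset 'N(O) := gFnorm _ _.
  have nOH := subset_trans sHG nOG.
  move=> /forall_inP/(_ (H / O)%G); rewrite subsetI quotientS //=.
  rewrite -quotientR // quotientS // => /(_ isT).
  rewrite -subG1 quotient_sub1 // => sHO.
  exact: pgroupS sHO (pcore_pgroup _ _).
rewrite trivg_card1; apply: contraT => neq1.
have /pdivP[p p_pr p_dv] : 1 < #|H| by rewrite ltn_neqAle eq_sym neq1 cardG_gt0.
by have := p'H p p_pr; rewrite /pgroup p'natE // p_dv.
Qed.

Lemma nilpotent_pcore_sub (gT : finGroupType) (W H : {group gT}) :
  nilpotent W -> (forall p, prime p -> 'O_p(W) \subset H) -> W \subset H.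
Proof.
move=> /nilpotent_Fitting/bigdprodW defW sWH; rewrite -{1}defW big_seq_cond.
elim/big_ind: _ => [|A B sA sB|p]; rewrite ?sub1G ?mul_subG //.
by rewrite andbT mem_primes => /andP[p_pr _]; apply: sWH.
Qed.

(** A subgroup [H] contained in its commutator with the join is trivial modulo ['Z_n(G)], the
    quotient being nilpotent; then [H \subset [~: H, G]] pushes it down the upper central series to
    1. *)
Lemma joing_ucn_nil (gT : finGroupType) (G V : {group gT}) n :
  V \subset G -> nilpotent V -> nilpotent (V <*> 'Z_n(G)).
Proof.
move=> sVG nilV; have nZG := ucn_norm n G; have nZV := subset_trans sVG nZG.
have sWG : V <*> 'Z_n(G) \subset G by rewrite join_subG sVG ucn_sub.
apply/forall_inP=> H; rewrite subsetI => /andP[sHW sHR].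
have sHG := subset_trans sHW sWG.
have sHZ : H \subset 'Z_n(G).
  set Z := 'Z_n(G)%G in nZG nZV sWG sHW sHR *.
  have nilWZ : nilpotent ((V <*> Z) / Z) by rewrite quotientYidr // quotient_nil.
  suffices: (H / Z)%G == 1 :> {set _}.
    by rewrite /= -subG1 quotient_sub1 // (subset_trans sHG).
  apply: (forall_inP nilWZ (H / Z)%G); rewrite subsetI.
  apply/andP; split; first exact: quotientS.
  by rewrite /= -quotientR ?(subset_trans sHG) ?(subset_trans sWG) //; apply: quotientS.
elim: n sHZ {nZG nZV sWG sHW sHR} (subset_trans sHR (commgS H sWG)) => [|n IHn] sHZ sHR.
  by rewrite ucn0 in sHZ; apply/eqP/trivgP.
apply: IHn => //; apply: subset_trans sHR _; apply: subset_trans (ucn_comm n G).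
exact: commSg.
Qed.

(** ['O_p^'(A)] centralizes ['O_p(A)], which contains [N]. *)
Lemma nilpotent_quotient_cent_pgroup (gT : finGroupType) (p : nat)
    (G A N : {group gT}) :
    A \subset G -> nilpotent A -> N <| G -> p.-group N -> N \subset A ->
  p.-group (A / 'C_G(N)).
Proof.
move=> sAG nilA nsNG pN sNA.
have nCG : G \subset 'N('C_G(N)).
  by rewrite normsI ?normG // norms_cent ?normal_norm.
have [_ defA cO _] := dprodP (nilpotent_pcoreC p nilA).
have sNO : N \subset 'O_p(A) by rewrite sub_Hall_pcore ?nilpotent_pcore_Hall.
have sO pi : 'O_pi(A) \subset G by rewrite (subset_trans (pcore_sub _ _)).
rewrite -defA quotientMl ?(subset_trans (sO _)) //.
rewrite (quotientS1 (_ : 'O_p^'(A) \subset _)) ?mulg1 ?quotient_pgroup ?pcore_pgroup //.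
by rewrite subsetI sO (subset_trans cO) ?centS.
Qed.

(** Joining the hypercentre to [V] keeps it nilpotent, so maximality puts the hypercentre in [V].
    Conversely each p-core of [gcore V G] lies in both ['F(G)] and [V]; these act on it as p-groups,
    hence so does their product [G]. *)
Lemma gcore_maximal_nilpotent (gT : finGroupType) (G V : {group gT}) :
  maximal_nilpotent G V -> G = 'F(G) * V :> {set gT} -> gcore V G = hypercentre G.
Proof.
move=> /maxgroupP[/andP[sVG nilV] maxV] defG.
have nsWG : gcore V G <| G by apply: gcore_normal.
have nilW : nilpotent (gcore V G) by apply: nilpotentS nilV; apply: gcore_sub.
apply/eqP; rewrite eqEsubset; apply/andP; split; last first.
  rewrite hypercentreE gcore_max ?ucn_norm // -(maxV (V <*> 'Z_(#|G|)(G))%G).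
  - exact: joing_subr.
  - by rewrite join_subG sVG ucn_sub joing_ucn_nil.
  exact: joing_subl.
rewrite hypercentreE; apply: nilpotent_pcore_sub => //= p p_pr; rewrite -hypercentreE.
pose N := 'O_p(gcore V G)%G; have nsNG : N <| G by apply: gFnormal_trans.
have pN : p.-group N by apply: pcore_pgroup.
have sNW : N \subset gcore V G by apply: pcore_sub.
have sNF : N \subset 'F(G) by rewrite Fitting_max // (pgroup_nil pN).
apply: (pgroup_sub_hypercentre nsNG pN).
have nCG : G \subset 'N('C_G(N)).
  by rewrite normsI ?normG // norms_cent ?normal_norm.
have -> : G / 'C_G(N) = ('F(G) / 'C_G(N)) * (V / 'C_G(N)).
  by rewrite -quotientMl -?defG // (subset_trans (Fitting_sub G)).
rewrite pgroupM.
rewrite !nilpotent_quotient_cent_pgroup ?Fitting_sub ?Fitting_nil //.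
exact: subset_trans sNW (gcore_sub _ _).
Qed.

Section HallNilpotentExtension.

Variables (gT : finGroupType) (G D E : {group gT}) (pi : nat_pred).
Hypotheses (hallD : pi.-Hall(G) D) (nsDG : D <| G) (nilD : nilpotent D).
Hypotheses (complE : E \in [complements to D in G]) (nilE : nilpotent E).
Hypothesis pnilG : forall p, prime p -> p \notin pi -> p_nilpotent p G.

Let sub_pi_D (H : {group gT}) : H \subset G -> pi.-group H -> H \subset D.
Proof.
move=> sHG piH; rewrite -(normal_Hall_pcore hallD nsDG).
by rewrite sub_Hall_pcore ?(normal_Hall_pcore hallD nsDG).
Qed.

(** ['C_G(D)] is p-nilpotent for every p: for p in [pi], its p-subgroups lie in [D] and are
    therefore central in it. *)
Lemma cent_Hall_sub_Fitting : 'C_G(D) \subset 'F(G).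
Proof.
apply: Fitting_max.
  by rewrite /= -{2}(setIidPl (normal_norm nsDG)) subcent_normal.
apply: nilpotent_p_nilpotent => p p_pr.
have [pip | pi'p] := boolP (p \in pi); last first.
  exact: p_nilpotentS (subsetIl _ _) (pnilG p_pr pi'p).
apply: frobenius_p_nilpotent; apply/frobenius_atP=> Q sQC pQ x /setIP[/setIP[_ Cx] _] _.
apply: subsetP (centS _) x Cx; apply: sub_pi_D.
  exact: subset_trans sQC (subsetIl _ _).
by apply: pi_pnat pQ _.
Qed.

(** If [V] is nilpotent above ['F(G)], its pi-part lies in [D], and its pi'-part centralizes [D]. *)
Lemma Fitting_maximal_nilpotent : maximal_nilpotent G 'F(G)%G.
Proof.
apply/maxgroupP; split; first by rewrite Fitting_sub Fitting_nil.
move=> V /andP[sVG nilV] sFV; apply/eqP; rewrite eqEsubset sFV andbT.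
have sDF : D \subset 'F(G) by apply: Fitting_max.
have [_ defV cO _] := dprodP (nilpotent_pcoreC pi nilV).
have sO rho : 'O_rho(V) \subset G by rewrite (subset_trans (pcore_sub _ _)).
rewrite -{1}defV mul_subG //.
  exact: subset_trans (sub_pi_D (sO _) (pcore_pgroup _ _)) sDF.
apply: subset_trans cent_Hall_sub_Fitting; rewrite subsetI sO /=.
apply: (subset_trans cO); apply: centS.
rewrite sub_Hall_pcore ?nilpotent_pcore_Hall ?(pHall_pgroup hallD) //.
exact: subset_trans sDF sFV.
Qed.

(** For p outside [pi], p-nilpotence makes [G] act on ['O_p(G)] as a p-group, so ['O_p(G)] is
    hypercentral. *)
Lemma Fitting_hypercentre : 'F(G) = D * hypercentre G.
Proof.
have sDF : D \subset 'F(G) by apply: Fitting_max.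
rewrite hypercentreE.
have nDZ : 'Z_(#|G|)(G) \subset 'N(D).
  exact: subset_trans (ucn_sub _ _) (normal_norm nsDG).
rewrite -norm_joinEr //; apply/eqP; rewrite eqEsubset join_subG sDF /= andbC.
rewrite Fitting_max ?ucn_normal ?ucn_nilpotent //=.
apply: nilpotent_pcore_sub (Fitting_nil G) _ => p p_pr; rewrite p_core_Fitting.
have [pip | pi'p] := boolP (p \in pi).
  apply: subset_trans (joing_subl _ _); apply: sub_pi_D (pcore_sub _ _) _.
  by apply: pi_pnat (pcore_pgroup _ _) _.
apply: subset_trans (joing_subr _ _); rewrite -hypercentreE.
apply: pgroup_sub_hypercentre (pcore_normal _ _) (pcore_pgroup _ _) _.
have := p_nilpotent_frobenius (pnilG p_pr pi'p) (pcore_sub p G) (pcore_pgroup p G).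
by rewrite (setIidPl (normal_norm (pcore_normal _ _))).
Qed.

(** [E] and ['N_D(E)] normalize each other and meet trivially, so their product ['N_G(E)] is
    nilpotent. It is self-normalizing because [E] is its pi'-core. *)
Lemma carter_norm_complement : carter_subgroup G 'N_G(E).
Proof.
have [tiDE defG] := complP complE.
have sEG : E \subset G by rewrite -defG mulG_subr.
have sEN : E \subset 'N_G(E) by rewrite subsetI sEG normG.
have defN : 'N_G(E) = E * 'N_D(E).
  by rewrite -{1}defG setIC -group_modr ?normG // normC ?subsetIl // setIC.
have hallE : pi^'.-Hall(G) E by rewrite -(compl_pHall _ hallD).
have hallEN : pi^'.-Hall('N_G(E)) E.
  by apply: pHall_subl sEN _ hallE; apply: subsetIl.
have defE : 'O_pi^'('N_G(E)) = E.
  by apply: normal_Hall_pcore hallEN _; rewrite /normal sEN subsetIr.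
split; [exact: groupP | exact: subsetIl | rewrite defN mulg_nil |].
- by rewrite nilE (nilpotentS (subsetIl _ _)).
- apply/commG1P/trivgP; rewrite -tiDE.
  rewrite commg_subI // subsetI ?subsetIl ?subsetIr ?subxx //.
  by rewrite (subset_trans sEG) ?normal_norm.
apply/eqP; rewrite eqEsubset [X in _ && X]subsetI subsetIl normG andbT.
rewrite subsetI subsetIl -{2}defE.
by rewrite andbT /=; apply: gFnorm_trans; apply: subsetIr.
Qed.

End HallNilpotentExtension.

(** * A Sylow basis from a Hall subgroup and its complement *)

Section SylowBasis.

Variables (gT : finGroupType) (G D E : {group gT}) (pi : nat_pred).
Hypotheses (hallD : pi.-Hall(G) D) (nsDG : D <| G) (nilD : nilpotent D).
Hypotheses (complE : E \in [complements to D in G]) (nilE : nilpotent E).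

(** The primes of [D] come first, so that the indices below [r] are those of the normal members.
    [basis_at] takes any natural number, which lets the products be re-indexed over intervals. *)
Let s := primes #|D| ++ primes #|E|.
Let r := size (primes #|D|).
Let basis_at (i : nat) : {group gT} :=
  if i < r then 'O_(nth 0 s i)(D)%G else 'O_(nth 0 s i)(E)%G.

Definition split_sylow_basis (i : 'I_(size s)) : {group gT} := basis_at i.
Local Notation B := split_sylow_basis.

Let defG : D * E = G. Proof. by case/complP: complE. Qed.
Let hallE : pi^'.-Hall(G) E. Proof. by rewrite -(compl_pHall _ hallD). Qed.
Let sEG : E \subset G. Proof. exact: pHall_sub hallE. Qed.
Let le_r_s : r <= size s. Proof. by rewrite size_cat leq_addr. Qed.

Lemma prod_split_basis_lt :
  \prod_(i < size s | i < r) (B i : {set gT}) = D.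
Proof.
rewrite -(big_mkord (fun i => i < r) (fun i => basis_at i : {set gT})).
rewrite -(big_nat_widen 0 _ _ xpredT) // -[RHS](bigdprodW (nilpotent_Fitting nilD)).
rewrite [RHS](big_nth 0); apply: eq_big_nat => i /= lt_i_r.
by rewrite /basis_at lt_i_r nth_cat -/r lt_i_r.
Qed.

Lemma prod_split_basis_geq :
  \prod_(i < size s | r <= i) (B i : {set gT}) = E.
Proof.
rewrite -(big_mkord (fun i => r <= i) (fun i => basis_at i : {set gT})).
rewrite -(big_nat_widenl _ _ _ xpredT) // -[RHS](bigdprodW (nilpotent_Fitting nilE)).
rewrite [RHS](big_nth 0) -{1}[r]add0n big_addn size_cat addKn; apply: eq_bigr => i _.
by rewrite /basis_at ltnNge leq_addl nth_cat -/r ltnNge leq_addl /= addnK.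
Qed.

Lemma split_basis_lt (i : 'I_(size s)) : i < r ->
  let p := nth 0 s i in [/\ prime p, p \in pi, p.-Sylow(G) (B i) & B i <| G].
Proof.
move=> lt_i_r p; rewrite /B /basis_at lt_i_r -/p.
have: p \in primes #|D| by rewrite /p nth_cat -/r lt_i_r mem_nth.
move=> piDp; have pip : p \in pi by apply: (pnatPpi (pHall_pgroup hallD)).
split=> //; first by move: piDp; rewrite mem_primes => /and3P[].
  exact: subHall_Sylow hallD pip (nilpotent_pcore_Hall _ nilD).
exact: gFnormal_trans.
Qed.

Lemma split_basis_geq (i : 'I_(size s)) : r <= i ->
  let p := nth 0 s i in [/\ prime p, p \notin pi, p.-Sylow(G) (B i) & B i <| E].
Proof.
move=> le_r_i p; rewrite /B /basis_at ltnNge le_r_i -/p /=.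
have: p \in primes #|E|.
  rewrite /p nth_cat -/r ltnNge le_r_i mem_nth //= ltn_subLR // -size_cat.
  exact: ltn_ord.
move=> piEp; have pi'p : p \in pi^' by apply: (pnatPpi (pHall_pgroup hallE)).
split=> //; first by move: piEp; rewrite mem_primes => /and3P[].
  exact: subHall_Sylow hallE pi'p (nilpotent_pcore_Hall _ nilE).
exact: pcore_normal.
Qed.

Lemma split_basis_Sylow (i : 'I_(size s)) : (nth 0 s i).-Sylow(G) (B i).
Proof.
by case: (ltnP i r) => [/split_basis_lt | /split_basis_geq] [].
Qed.

Lemma mem_split_primes p : (p \in s) = (p \in \pi(G)).
Proof.
rewrite mem_cat -primesM ?cardG_gt0 // -TI_cardMg ?defG //.
by case/complP: complE.
Qed.

Lemma uniq_split_primes : uniq s.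
Proof.
rewrite cat_uniq !primes_uniq andbT /=; apply/hasPn=> p piEp; apply/negP=> piDp.
have := pnatPpi (pHall_pgroup hallE) piEp.
by rewrite inE /= (pnatPpi (pHall_pgroup hallD) piDp).
Qed.

Lemma split_sylow_basisP : sylow_basis G B.
Proof.
split=> [i | p piGp | i j].
- exists (nth 0 s i); last exact: split_basis_Sylow.
  by rewrite -mem_split_primes mem_nth.
- have sp : p \in s by rewrite mem_split_primes.
  have lt_p : index p s < size s by rewrite index_mem.
  exists (Ordinal lt_p); split=> [|j sylBj].
    by have := split_basis_Sylow (Ordinal lt_p); rewrite /= nth_index.
  apply: val_inj; rewrite /= -(index_uniq 0 (ltn_ord j) uniq_split_primes).
  congr (index _ s); apply/eqP.
  have pBj : p %| #|B j|.
    by rewrite (card_Hall sylBj) p_part dvdn_exp // logn_gt0.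
  have p_pr : prime p by move: piGp; rewrite mem_primes => /and3P[].
  by have := pgroupP (pHall_pgroup (split_basis_Sylow j)) p p_pr pBj.
(* Either one factor is normal in [G], or both are normal in [E]. *)
have [lt_i_r | le_r_i] := ltnP i r.
  have [_ _ sylBi nsBi] := split_basis_lt lt_i_r.
  apply/esym/normC; apply: subset_trans (normal_norm nsBi).
  exact: pHall_sub (split_basis_Sylow j).
have [lt_j_r | le_r_j] := ltnP j r.
  have [_ _ _ nsBj] := split_basis_lt lt_j_r.
  apply: normC; apply: subset_trans (normal_norm nsBj).
  exact: pHall_sub (split_basis_Sylow i).
have [_ _ _ nsBi] := split_basis_geq le_r_i.
have [_ _ _ nsBj] := split_basis_geq le_r_j.
by apply: normC; apply: subset_trans (normal_sub nsBi) (normal_norm nsBj).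
Qed.

Hypothesis pnilG : forall p, prime p -> p \notin pi -> p_nilpotent p G.
Hypothesis nnG : forall p, prime p -> p \notin pi -> ~~ p.-Sylow(G) 'O_p(G).
Hypotheses (ntD : D :!=: 1) (ntE : E :!=: 1).

Lemma split_type_b : type_b G.
Proof.
split.
  rewrite (series_sol nsDG) nilpotent_sol //=.
  by rewrite -defG quotientMidl quotient_sol // nilpotent_sol.
have size_primes (H : {group gT}) : H :!=: 1 -> 0 < size (primes #|H|).
  move=> ntH; have [p [p_pr p_dv]] : exists p, prime p /\ p %| #|H|.
    by exists (pdiv #|H|); rewrite pdiv_dvd pdiv_prime // cardG_gt1.
  have: p \in primes #|H| by rewrite mem_primes p_pr cardG_gt0.
  by case: (primes _).
exists (size s), B; split; first exact: split_sylow_basisP.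
exists r; rewrite /= prod_split_basis_lt prod_split_basis_geq; split.
- split=> //.
  + rewrite size_primes //= size_cat -[X in X < _]addn0 ltn_add2l.
    exact: size_primes.
  + by move=> i /split_basis_lt[].
  move=> i /split_basis_geq[p_pr pi'p sylBi _].
  by apply: contra (nnG p_pr pi'p) => /(normal_Hall_pcore sylBi)->.
- split; first exact: Fitting_maximal_nilpotent hallD nsDG nilD pnilG.
  exact: Fitting_hypercentre hallD nsDG nilD pnilG.
- exact: carter_norm_complement hallD nsDG nilD complE nilE.
by move=> V; apply: gcore_maximal_nilpotent.
Qed.

End SylowBasis.

(** * The equivalence *)

Lemma frobenius_type_b (gT : finGroupType) (G : {group gT}) :
  (forall P : {group gT}, P \subset G -> primary P -> ~~ (P <|<| G) ->
     frobenius_normalizer_condition G P) ->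
  nilpotent G \/ type_b G.
Proof.
move=> frobG; have [nilG | nnilG] := boolP (nilpotent G); [by left | right].
(* A Sylow p-subgroup is normal exactly when ['O_p(G)] is Sylow. *)
pose pi : nat_pred := [pred p | p.-Sylow(G) 'O_p(G)].
have pnilG p : prime p -> p \notin pi -> p_nilpotent p G.
  move=> p_pr pi'p; have [P sylP] := Sylow_exists p G.
  apply: (nonnormal_Sylow_p_nilpotent frobG p_pr sylP).
  by apply: contra pi'p => nsPG; rewrite inE /= (normal_Hall_pcore sylP nsPG).
(* Taken inside ['F(G)], [D] is nilpotent at once; it is a Hall subgroup because it contains each
   normal Sylow subgroup ['O_q(G)]. *)
pose D := 'O_pi('F(G))%G; have nilF := Fitting_nil G.
have nsDG : D <| G by apply: gFnormal_trans; apply: Fitting_normal.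
have nilD : nilpotent D by apply: nilpotentS nilF; apply: pcore_sub.
have hallD : pi.-Hall(G) D.
  rewrite /pHall normal_sub //= pcore_pgroup /=; apply/pnatP=> // q q_pr q_dv.
  apply/negP=> piq; have sylO : q.-Sylow(G) 'O_q(G) := piq.
  have sOD : 'O_q(G) \subset D.
    rewrite -p_core_Fitting sub_Hall_pcore ?nilpotent_pcore_Hall ?pcore_sub //.
    by apply: pi_pnat (pcore_pgroup _ _) _.
  have /and3P[_ _] := sylO.
  by rewrite p'natE // -(Lagrange_index (normal_sub nsDG) sOD) dvdn_mulr.
have [E complE] := splitsP (SchurZassenhaus_split (pHall_Hall hallD) nsDG).
have [tiDE defG] := complP complE.
have hallE : pi^'.-Hall(G) E by rewrite -(compl_pHall _ hallD).
have nilE : nilpotent E.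
  apply: nilpotent_p_nilpotent => p p_pr.
  have [pip | pi'p] := boolP (p \in pi); last first.
    by apply: p_nilpotentS (pnilG p p_pr pi'p); apply: pHall_sub hallE.
  rewrite p_nilpotentE pcore_pgroup_id ?trivg_quotient ?pgroup1 //.
  apply: sub_in_pnat (pHall_pgroup hallE) => q _ pi'q.
  by rewrite inE /= inE; apply: contraNneq pi'q => ->.
(* If [D] or [E] were trivial, [G] would equal the other one and be nilpotent. *)
apply: (split_type_b hallD nsDG nilD complE nilE pnilG) => //.
  by apply: contraNneq nnilG => D1; rewrite -defG D1 mul1g.
by apply: contraNneq nnilG => E1; rewrite -defG E1 mulg1.
Qed.

Theorem theorem1p4 (gT : finGroupType) (G : {group gT}) :
  (forall P : {group gT}, P \subset G -> primary P -> ~~ (P <|<| G) ->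
     frobenius_normalizer_condition G P)
  <-> nilpotent G \/ type_b G.
Proof.
split=> [|[nilG | bG] P sPG]; first exact: frobenius_type_b.
  by move=> _; rewrite nilpotent_subnormal.
exact: type_b_frobenius.
Qed.
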